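(* Let $\lambda$ be a nonzero real number and $r$ a positive integer. For every integer $n\ge 0$ (and every real $x$), $$C_{n}^{(r)}(x)=\sum_{k=0}^{n}\mathcal{E}_{k,\lambda}^{(r)}(x)\,S_{1,\lambda}(n,k).$$ In particular, $$C_{n}^{(r)}=\sum_{k=0}^{n}\mathcal{E}_{k,\lambda}^{(r)}\,S_{1,\lambda}(n,k).$$
   Context: All generating functions are formal power series in $t$ with real coefficients. For $x\in\mathbb{R}$: $(x)_0=1$, $(x)_n=x(x-1)\cdots(x-n+1)$ for $n\ge1$; $(x)_{0,\lambda}=1$, $(x)_{n,\lambda}=x(x-\lambda)\cdots(x-(n-1)\lambda)$ for $n\ge 1$. The degenerate exponential is $e_\lambda^x(t)=(1+\lambda t)^{x/\lambda}=\sum_{n\ge0}(x)_{n,\lambda}\frac{t^n}{n!}$, $e_\lambda(t)=e_\lambda^1(t)$ (and $e_\lambda^{-1}(t)$ is the case $x=-1$). The degenerate Stirling numbers of the first kind $S_{1,\lambda}(n,l)$ are defined by $(x)_n=\sum_{l=0}^n S_{1,\lambda}(n,l)(x)_{l,\lambda}$ (polynomial identity in $x$, $n\ge0$). The type 2 degenerate Euler polynomials of order $r$ are defined by $\left(\frac{2}{e_\lambda(t)+e_\lambda^{-1}(t)}\right)^r e_\lambda^x(t)=\sum_{n\ge0}\mathcal{E}_{n,\lambda}^{(r)}(x)\frac{t^n}{n!}$, and $\mathcal{E}_{n,\lambda}^{(r)}=\mathcal{E}_{n,\lambda}^{(r)}(0)$. The type 2 Changhee polynomials of order $r$ are defined by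 $\left(\frac{2}{(1+t)+(1+t)^{-1}}\right)^r(1+t)^x=\sum_{n\ge0}C_n^{(r)}(x)\frac{t^n}{n!}$, and $C_n^{(r)}=C_n^{(r)}(0)$. *)

(* Defs.v *)
From HB Require Import structures.
From mathcomp Require Import all_boot all_order all_algebra.
From mathcomp Require Import ring boolp reals.

Set Implicit Arguments.
Unset Strict Implicit.
Unset Printing Implicit Defensive.

Import Order.TTheory GRing.Theory Num.Theory.
Local Open Scope ring_scope.

(* Formal power series.  The record (rather than a bare [nat -> R]) keeps the
   Cauchy product apart from the pointwise ring structure on functions. *)
Record fps (R : Type) := Fps { coefs :> nat -> R }.

Lemma fpsP (R : Type) (f g : fps R) : (forall n, f n = g n) <-> f = g.
Proof.
split=> [|-> //]; case: f g => f [g] /= fg; congr Fps; exact: funext.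
Qed.

HB.instance Definition _ (R : Type) := gen_eqMixin (fps R).
HB.instance Definition _ (R : Type) := gen_choiceMixin (fps R).

Section FpsZmodule.
Variable R : zmodType.
Implicit Types f g h : fps R.

Definition fps_zero : fps R := Fps (fun=> 0).
Definition fps_opp f : fps R := Fps (fun n => - f n).
Definition fps_add f g : fps R := Fps (fun n => f n + g n).

Fact fps_addA : associative fps_add.
Proof. by move=> f g h; apply/fpsP => n /=; rewrite addrA. Qed.
Fact fps_addC : commutative fps_add.
Proof. by move=> f g; apply/fpsP => n /=; rewrite addrC. Qed.
Fact fps_add0 : left_id fps_zero fps_add.
Proof. by move=> f; apply/fpsP => n /=; rewrite add0r. Qed.
Fact fps_addN : left_inverse fps_zero fps_opp fps_add.
Proof. by move=> f; apply/fpsP => n /=; rewrite addNr. Qed.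

HB.instance Definition _ :=
  GRing.isZmodule.Build (fps R) fps_addA fps_addC fps_add0 fps_addN.

Lemma coef_fps0 n : (0 : fps R) n = 0. Proof. by []. Qed.
Lemma coef_fpsD f g n : (f + g) n = f n + g n. Proof. by []. Qed.
Lemma coef_fpsN f n : (- f) n = - f n. Proof. by []. Qed.
End FpsZmodule.

Section FpsRing.
Variable R : comNzRingType.
Implicit Types f g h : fps R.

Definition fps_one : fps R := Fps (fun n => (n == 0%N)%:R).
Definition fps_mul f g : fps R := Fps (fun n => \sum_(i < n.+1) f i * g (n - i)%N).

Local Definition trunc m f : {poly R} := \poly_(i < m) f i.

Local Lemma fps_mul_trunc m n f g :
  (n < m)%N -> fps_mul f g n = (trunc m f * trunc m g)`_n.
Proof.
move=> nm; rewrite coefM /=; apply: eq_bigr => i _.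
have im : (i < m)%N by apply: leq_ltn_trans nm; rewrite -ltnS.
by rewrite !coef_poly im (leq_ltn_trans (leq_subr i n) nm).
Qed.

Fact fps_mulC : commutative fps_mul.
Proof.
move=> f g; apply/fpsP => n.
by rewrite (fps_mul_trunc f g (ltnSn n)) mulrC -fps_mul_trunc.
Qed.

Fact fps_mulA : associative fps_mul.
Proof.
have E f g h n : fps_mul (fps_mul f g) h n =
    (trunc n.+1 f * trunc n.+1 g * trunc n.+1 h)`_n.
  rewrite [RHS]coefM -[LHS]/(\sum_(i < n.+1) fps_mul f g i * h (n - i)%N).
  apply: eq_bigr => i _.
  by rewrite (@fps_mul_trunc n.+1 i f g) ?ltn_ord // coef_poly ltnS leq_subr.
move=> f g h; apply/fpsP => n.
rewrite fps_mulC !E; congr (_`_n).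
by rewrite mulrC mulrA.
Qed.

Fact fps_mul1 : left_id fps_one fps_mul.
Proof.
move=> f; apply/fpsP => n /=; rewrite big_ord_recl /= mul1r subn0.
by rewrite big1 ?addr0 // => i _; rewrite mul0r.
Qed.

Fact fps_mulDl : left_distributive fps_mul +%R.
Proof.
move=> f g h; apply/fpsP => n /=; rewrite -big_split /=.
by apply: eq_bigr => i _; rewrite mulrDl.
Qed.

Fact fps_one_neq0 : fps_one != 0.
Proof. by apply/eqP => /fpsP/(_ 0%N)/=/eqP; rewrite oner_eq0. Qed.

HB.instance Definition _ := GRing.Zmodule_isComNzRing.Build (fps R)
  fps_mulA fps_mulC fps_mul1 fps_mulDl fps_one_neq0.

Lemma coef_fps1 n : (1 : fps R) n = (n == 0%N)%:R. Proof. by []. Qed.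
Lemma coef_fpsM f g n : (f * g) n = \sum_(i < n.+1) f i * g (n - i)%N.
Proof. by []. Qed.

Definition fpsX : fps R := Fps (fun n => (n == 1%N)%:R).

Lemma coef_fpsXM f n : (fpsX * f) n = if n is m.+1 then f m else 0.
Proof.
rewrite coef_fpsM; case: n => [|n]; first by rewrite big_ord1 /= mul0r.
rewrite !big_ord_recl /= mul0r add0r mul1r subn1 /= big1 ?addr0 // => i _.
by rewrite mul0r.
Qed.
End FpsRing.

Section FpsUnitRing.
Variable R : comUnitRingType.
Implicit Types f g h : fps R.

(* [fps_inv_seq f n] lists the first n coefficients of 1 / f. *)
Fixpoint fps_inv_seq f n : seq R :=
  if n is k.+1 then
    let s := fps_inv_seq f k in
    rcons s ((f 0%N)^-1 *
             ((k == 0%N)%:R - \sum_(i < k) f i.+1 * s`_(k - i.+1)%N))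
  else [::].

Definition fps_unit : {pred fps R} := fun f => f 0%N \is a GRing.unit.
Definition fps_inv f : fps R :=
  if fps_unit f then Fps (fun n => (fps_inv_seq f n.+1)`_n) else f.

Local Lemma size_fps_inv_seq f n : size (fps_inv_seq f n) = n.
Proof. by elim: n => //= n IH; rewrite size_rcons IH. Qed.

Local Lemma nth_fps_inv_seq f m n :
  (m < n)%N -> (fps_inv_seq f n)`_m = (fps_inv_seq f m.+1)`_m.
Proof.
elim: n => // n IH; rewrite ltnS leq_eqVlt => /orP[/eqP-> //|mn].
by rewrite [LHS]/= nth_rcons size_fps_inv_seq mn IH.
Qed.

Fact fps_mulVx : {in fps_unit, left_inverse 1 fps_inv *%R}.
Proof.
move=> f; rewrite unfold_in => f0; rewrite /fps_inv (f0 : fps_unit f = true) mulrC.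
apply/fpsP => n; rewrite coef_fpsM big_ord_recl subn0 /=.
rewrite nth_rcons size_fps_inv_seq ltnn eqxx mulrA divrr // mul1r.
rewrite -[RHS]addr0 -addrA; congr (_ + _).
apply/eqP; rewrite addrC subr_eq0; apply/eqP/eq_bigr => i _.
rewrite /bump add1n; congr (_ * _).
rewrite -[LHS]/((fps_inv_seq f (n - i.+1).+1)`_(n - i.+1)).
by rewrite -(@nth_fps_inv_seq _ _ n) // subnS prednK ?subn_gt0 // leq_subr.
Qed.

Fact fps_unitPl f g : g * f = 1 -> fps_unit f.
Proof.
move=> /fpsP/(_ 0%N); rewrite coef_fpsM big_ord1 /= => gf.
by apply/unitrPr; exists (g 0%N); rewrite mulrC.
Qed.

Fact fps_inv_out : {in [predC fps_unit], fps_inv =1 id}.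
Proof. by move=> f /negbTE fU; rewrite /fps_inv (fU : fps_unit f = false). Qed.

HB.instance Definition _ := GRing.ComNzRing_hasMulInverse.Build (fps R)
  fps_mulVx fps_unitPl fps_inv_out.

Lemma unit_fpsE f : (f \is a GRing.unit) = (f 0%N \is a GRing.unit).
Proof. by []. Qed.
End FpsUnitRing.

(* (x)_n and (x)_{n,lambda}, over an arbitrary ring so that x may also be a
   polynomial indeterminate *)
Definition falling (A : comNzRingType) (x : A) (n : nat) : A :=
  \prod_(i < n) (x - i%:R).

Definition dfalling (A : comNzRingType) (lam x : A) (n : nat) : A :=
  \prod_(i < n) (x - i%:R * lam).

Lemma horner_falling (R : comNzRingType) (x : R) n :
  (falling 'X n).[x] = falling x n.
Proof.
rewrite /falling horner_prod; apply: eq_bigr => i _.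
by rewrite -polyC_natr !hornerE.
Qed.

Lemma horner_dfalling (R : comNzRingType) (lam x : R) n :
  (dfalling lam%:P 'X n).[x] = dfalling lam x n.
Proof.
rewrite /dfalling horner_prod; apply: eq_bigr => i _.
by rewrite -polyC_natr !hornerE.
Qed.

Section DegenerateStirling.
Variables (R : comNzRingType) (lam : R).

Local Lemma dfalling_monic n :
  (dfalling lam%:P 'X n \is monic) /\ size (dfalling lam%:P 'X n) = n.+1.
Proof.
have -> : dfalling lam%:P 'X n = \prod_(i < n) ('X - (i%:R * lam)%:P).
  by apply: eq_bigr => i _; rewrite polyCM polyC_natr.
split; first exact: monic_prod_XsubC.
by rewrite size_prod_XsubC /index_enum -enumT size_enum_ord.
Qed.

Local Lemma size_falling n : size (falling ('X : {poly R}) n) = n.+1.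
Proof.
have -> : falling 'X n = \prod_(i < n) ('X - (i%:R : R)%:P).
  by apply: eq_bigr => i _; rewrite polyC_natr.
by rewrite size_prod_XsubC /index_enum -enumT size_enum_ord.
Qed.

Local Lemma dfalling_span n (p : {poly R}) : (size p <= n)%N ->
  exists c : nat -> R, p = \sum_(l < n) c l *: dfalling lam%:P 'X l.
Proof.
elim: n p => [p|n IH p sp].
  by rewrite leqn0 size_poly_eq0 => /eqP->; exists (fun=> 0); rewrite big_ord0.
have [mD sD] := dfalling_monic n.
have /IH[c pE] : (size (p - p`_n *: dfalling lam%:P 'X n)%R <= n)%N.
  apply/leq_sizeP => j; rewrite leq_eqVlt coefB coefZ => /orP[/eqP<-|nj].
    have -> : (dfalling lam%:P 'X n)`_n = 1.
      by move/monicP: mD; rewrite /lead_coef sD.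
    by rewrite mulr1 subrr.
  rewrite (nth_default 0 (leq_trans sp nj)).
  by rewrite [X in _ - _ * X]nth_default ?sD // mulr0 subr0.
exists (fun l => if l == n then p`_n else c l).
rewrite big_ord_recr /= eqxx -[LHS](subrK (p`_n *: dfalling lam%:P 'X n)).
congr (_ + _); rewrite pE; apply: eq_bigr => i _.
by rewrite (ltn_eqF (ltn_ord i)).
Qed.

Local Lemma dfalling_free n (c : nat -> R) :
  \sum_(l < n) c l *: dfalling lam%:P 'X l = 0 ->
  forall l, (l < n)%N -> c l = 0.
Proof.
elim: n => // n IH; rewrite big_ord_recr /= => c0.
have cn : c n = 0.
  move/(congr1 (fun p : {poly R} => p`_n)): (c0).
  rewrite coefD coefZ coef0 coef_sum big1 => [|i _].
    have [mD sD] := dfalling_monic n.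
    by move/monicP: mD; rewrite /lead_coef sD add0r => ->; rewrite mulr1.
  have [_ sD] := dfalling_monic i.
  by rewrite coefZ nth_default ?sD ?mulr0.
move: c0; rewrite cn scale0r addr0 => /IH c0 l.
by rewrite ltnS leq_eqVlt => /orP[/eqP->|/c0].
Qed.

Fact stirling1_exists n : exists c : nat -> R,
  falling 'X n = \sum_(l < n.+1) c l *: dfalling lam%:P 'X l.
Proof. by apply: dfalling_span; rewrite size_falling. Qed.

(* S_{1,lambda}(n, l): the coefficients in the defining identity
   (x)_n = sum_{l <= n} S_{1,lambda}(n, l) (x)_{l,lambda}, which determines
   them for l <= n ([stirling1_unique]); the value for l > n is irrelevant. *)
Definition stirling1 (n : nat) : nat -> R := sval (cid (stirling1_exists n)).

Lemma stirling1P n :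
  falling 'X n = \sum_(l < n.+1) stirling1 n l *: dfalling lam%:P 'X l.
Proof. exact: svalP (cid (stirling1_exists n)). Qed.

Lemma stirling1_unique n (c : nat -> R) :
  falling 'X n = \sum_(l < n.+1) c l *: dfalling lam%:P 'X l ->
  forall l, (l <= n)%N -> c l = stirling1 n l.
Proof.
rewrite stirling1P => /esym/eqP; rewrite -subr_eq0 -sumrB => /eqP E l ln.
apply/eqP; rewrite -subr_eq0; apply/eqP.
apply: (@dfalling_free n.+1 (fun l => c l - stirling1 n l)) => //.
by rewrite -[RHS]E; apply: eq_bigr => i _; rewrite scalerBl.
Qed.
End DegenerateStirling.

Section GeneratingFunctions.
Variable R : fieldType.

Definition egf (a : nat -> R) : fps R := Fps (fun n => a n / n`!%:R).

(* (1 + t)^x as a binomial series *)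
Definition binom_series (x : R) : fps R := egf (falling x).

(* e_lambda^x(t) = (1 + lambda t)^(x / lambda), see [degexpE] *)
Definition degexp (lam x : R) : fps R := egf (dfalling lam x).

Definition euler_gf (lam : R) (r : nat) (x : R) : fps R :=
  (2 / (degexp lam 1 + degexp lam (-1))) ^+ r * degexp lam x.

Definition changhee_gf (r : nat) (x : R) : fps R :=
  (2 / ((1 + fpsX R) + (1 + fpsX R)^-1)) ^+ r * binom_series x.

Definition euler_poly (lam : R) (r n : nat) (x : R) : R :=
  n`!%:R * euler_gf lam r x n.

Definition changhee_poly (r n : nat) (x : R) : R :=
  n`!%:R * changhee_gf r x n.

Definition euler_num (lam : R) (r n : nat) : R := euler_poly lam r n 0.

Definition changhee_num (r n : nat) : R := changhee_poly r n 0.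
End GeneratingFunctions.

Section Checks.
Variable R : numFieldType.
Implicit Types lam x : R.

Local Lemma fact_neq0 n : n`!%:R != 0 :> R.
Proof. by rewrite pnatr_eq0 -lt0n fact_gt0. Qed.

Lemma euler_polyP lam r x :
  euler_gf lam r x = egf (fun n => euler_poly lam r n x).
Proof. by apply/fpsP => n /=; rewrite [RHS]mulrC mulKf ?fact_neq0. Qed.

Lemma changhee_polyP r x :
  changhee_gf r x = egf (fun n => changhee_poly r n x).
Proof. by apply/fpsP => n /=; rewrite [RHS]mulrC mulKf ?fact_neq0. Qed.

(* substituting u = lambda t in the binomial series (1 + u)^(x / lambda) *)
Lemma degexpE lam x n : lam != 0 ->
  degexp lam x n = binom_series (x / lam) n * lam ^+ n.
Proof.
move=> lam0 /=; rewrite mulrAC; congr (_ / _).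
rewrite -[in lam ^+ n](card_ord n) -prodr_const -big_split /=.
by apply: eq_bigr => i _; rewrite mulrBl divfK.
Qed.

Lemma binom_series1 : binom_series 1 = 1 + fpsX R.
Proof.
apply/fpsP => -[|[|n]]; rewrite coef_fpsD coef_fps1 /= /falling.
- by rewrite big_ord0 divr1 addr0.
- by rewrite big_ord1 subr0 divr1 add0r.
- by rewrite !big_ord_recl /= subrr mul0r mulr0 mul0r addr0.
Qed.

Lemma binom_seriesN1 : binom_series (-1) = (1 + fpsX R)^-1.
Proof.
have cE n : binom_series (-1) n = (-1) ^+ n :> R.
  rewrite /=; apply: (canLR (mulfK (fact_neq0 n))).
  elim: n => [|n IH]; first by rewrite /falling big_ord0 mulr1.
  rewrite /falling big_ord_recr -/(falling _ n) IH factS natrM exprS.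
  by rewrite -natr1 /=; ring.
have U : 1 + fpsX R \is a GRing.unit by rewrite unit_fpsE /= addr0 unitr1.
apply: (mulrI U); rewrite divrr // mulrDl mul1r; apply/fpsP => n.
rewrite coef_fpsD coef_fpsXM coef_fps1; case: n => [|n]; first by rewrite cE addr0.
by rewrite !cE exprS mulN1r addNr.
Qed.

Lemma degexp_unit lam : degexp lam 1 + degexp lam (-1) \is a GRing.unit.
Proof.
by rewrite unit_fpsE /= /dfalling !big_ord0 divr1 unitfE -[_ + _]/(2%:R) pnatr_eq0.
Qed.

Lemma changhee_unit : (1 + fpsX R) + (1 + fpsX R)^-1 \is a GRing.unit.
Proof.
rewrite -binom_seriesN1 -binom_series1.
by rewrite unit_fpsE /= /falling !big_ord0 divr1 unitfE -[_ + _]/(2%:R) pnatr_eq0.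
Qed.
End Checks.

(* Main.v *)
Require Import Defs.
From mathcomp Require Import all_boot all_order all_algebra.
From mathcomp Require Import reals.
From HB Require Import structures.
From mathcomp Require Import ring.

(** The map sending [sum_k a_k t^k / k!] to
    [sum_n (sum_k a_k S_{1,lambda}(n, k)) t^n / n!] is the substitution of the
    degenerate logarithm for t. By definition of S_{1,lambda} it sends
    e_lambda^x(t) to (1 + t)^x for all x. It is multiplicative: this holds on the
    exponentials because both families are additive in the exponent, and it
    extends to all series because a linear functional of finitely many
    coefficients that vanishes on every e_lambda^x(t) is zero, the polynomials
    (x)_{k,lambda} being linearly independent. So it is a ring morphism, and it
    sends the generating function of the Euler polynomials to that of the Changhee
    polynomials. *)

Import GRing.Theory Num.Theory.
Local Open Scope ring_scope.

Section CoefficientFunctionals.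
Variable R : numFieldType.
Implicit Types (f g h : fps R) (lam x y : R).

Lemma fact_unit n : n`!%:R != 0 :> R.
Proof. by rewrite pnatr_eq0 -lt0n fact_gt0. Qed.

(** In characteristic zero the first [size p] numerals are distinct, which is one root too many for
    a nonzero [p]. *)
Lemma poly_eq0_on (p : {poly R}) : (forall x, p.[x] = 0) -> p = 0.
Proof.
move=> p0; apply/eqP/contraT => pN0.
pose s := [seq (i%:R : R) | i <- iota 0 (size p)].
have /(max_poly_roots pN0) : all (root p) s by apply/allP => x _; apply/eqP.
rewrite size_map size_iota ltnn; apply.
by rewrite map_inj_uniq ?iota_uniq // => i j /eqP; rewrite eqr_nat => /eqP.
Qed.

(** The finite bound makes [phi (degexp lam x)] a polynomial in [x]. *)
Definition coef_functional N (phi : fps R -> R) :=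
  exists c : nat -> R, forall f, phi f = \sum_(k < N) c k * f k.

Lemma coef_functional_coef N n : (n < N)%N -> coef_functional N (fun f => f n).
Proof.
move=> nN; exists (fun k => (k == n)%:R) => f.
rewrite (bigD1 (Ordinal nN)) //= eqxx mul1r big1 ?addr0 // => i.
by rewrite -val_eqE /= => /negbTE->; rewrite mul0r.
Qed.

Lemma coef_functional_sum N n (a : nat -> R) (phi : nat -> fps R -> R) :
  (forall i, (i < n)%N -> coef_functional N (phi i)) ->
  coef_functional N (fun f => \sum_(i < n) a i * phi i f).
Proof.
elim: n => [_|n IH Hphi].
  by exists (fun=> 0) => f; rewrite big_ord0 big1 // => i _; rewrite mul0r.
have [c cE] := IH (fun i ni => Hphi i (ltnW ni)).
have [d dE] := Hphi n (ltnSn n).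
exists (fun k => c k + a n * d k) => f.
rewrite big_ord_recr /= cE dE mulr_sumr -big_split /=.
by apply: eq_bigr => i _; rewrite mulrDl mulrA.
Qed.

Lemma coef_functionalB N phi psi :
  coef_functional N phi -> coef_functional N psi ->
  coef_functional N (fun f => phi f - psi f).
Proof.
move=> [c cE] [d dE]; exists (fun k => c k - d k) => f.
by rewrite cE dE -sumrB; apply: eq_bigr => i _; rewrite mulrBl.
Qed.

(** A general [F] covers both [h * f] and [h * stirling_subst f]. *)
Lemma coef_functional_mul N n h (F : fps R -> fps R) : (n < N)%N ->
  (forall i, (i < N)%N -> coef_functional N (fun f => F f i)) ->
  coef_functional N (fun f => (h * F f) n).
Proof.
move=> nN HF.
have := @coef_functional_sum N n.+1 (fun i => h (n - i)%N) (fun i f => F f i).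
case=> [i|c cE]; first by move=> /leq_trans/(_ nN); exact: HF.
exists c => f; rewrite -cE mulrC coef_fpsM.
by apply: eq_bigr => i _; rewrite mulrC.
Qed.

Lemma coef_functional_degexp lam N phi : coef_functional N phi ->
  (forall x, phi (degexp lam x) = 0) -> forall f, phi f = 0.
Proof.
move=> [c cE] phi0 f.
suff c0 k : (k < N)%N -> c k = 0.
  by rewrite cE big1 // => i _; rewrite c0 ?mul0r.
(* This polynomial takes the value [phi (degexp lam x)] at [x]; the factorials come from [egf]. *)
move=> kN; have D0 : \sum_(l < N) (c l / l`!%:R) *: dfalling lam%:P 'X l = 0.
  apply: poly_eq0_on => x; rewrite horner_sum -[RHS](phi0 x) cE.
  apply: eq_bigr => i _.
  by rewrite hornerZ horner_dfalling /= mulrAC -mulrA.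
have /eqP := @Defs.dfalling_free R lam N (fun l => c l / l`!%:R) D0 k kN.
by rewrite mulf_eq0 invr_eq0 (negbTE (fact_unit k)) orbF => /eqP.
Qed.

Lemma degexp0 lam x : degexp lam x 0%N = 1.
Proof. by rewrite /= /dfalling big_ord0 divr1. Qed.

(** Coefficient form of [(1 + lam t) f' = x f]. *)
Lemma degexpS lam x n :
  n.+1%:R * degexp lam x n.+1 = (x - n%:R * lam) * degexp lam x n.
Proof.
rewrite /= /dfalling big_ord_recr /= factS natrM.
have nN0 : n.+1%:R != 0 :> R by rewrite pnatr_eq0.
by field; rewrite fact_unit; move: nN0; rewrite -natr1 addrC => ->.
Qed.

(* Both sides solve (1 + lam t) f' = (x + y) f. *)
Lemma degexpD lam x y : degexp lam (x + y) = degexp lam x * degexp lam y.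
Proof.
apply/fpsP; elim=> [|n IH]; first by rewrite coef_fpsM big_ord1 !degexp0 mulr1.
have nN0 : n.+1%:R != 0 :> R by rewrite pnatr_eq0.
apply: (mulfI nN0); rewrite degexpS IH !coef_fpsM.
move: (degexp lam x) (degexp lam y) (degexpS lam x) (degexpS lam y).
move=> a b aS bS {IH}.
(* Leibniz rule: the weight [n.+1] splits as [i + (n.+1 - i)]. *)
have -> : n.+1%:R * (\sum_(i < n.+2) a i * b (n.+1 - i)%N) =
    \sum_(i < n.+2) (i%:R * a i) * b (n.+1 - i)%N +
    \sum_(i < n.+2) a i * ((n.+1 - i)%N%:R * b (n.+1 - i)%N).
  rewrite mulr_sumr -big_split /=; apply: eq_bigr => i _.
  have -> : n.+1%:R = i%:R + (n.+1 - i)%N%:R :> R.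
    by rewrite -natrD subnKC // -ltnS.
  by ring.
(* The end terms of weight zero drop out, so both sums run over [i < n.+1], where the recurrences
   for [a] and [b] apply. *)
rewrite [X in _ = X + _]big_ord_recl [X in _ = _ + X]big_ord_recr /= !mul0r add0r.
rewrite subnn mul0r mulr0 addr0 mulr_sumr -big_split /=.
apply: eq_bigr => i _; have ni : (i <= n)%N by rewrite -ltnS.
rewrite /bump /= add1n subSS subSn // aS bS natrB //.
by ring.
Qed.

(** Gives [binom_series] the addition law [degexpD]. *)
Lemma binom_series_degexp x : binom_series x = degexp 1 x.
Proof.
apply/fpsP => n /=; congr (_ / _).
by apply: eq_bigr => i _; rewrite mulr1.
Qed.

Lemma degexp_at0 lam : degexp lam 0 = 1.
Proof.
apply/fpsP => -[|n]; first by rewrite degexp0.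
by rewrite /= /dfalling big_ord_recl mul0r subrr !mul0r.
Qed.

End CoefficientFunctionals.

Section StirlingTransform.
Variables (R : numFieldType) (lam : R).
Implicit Types (f g : fps R) (x y : R).

(* f(t) |-> f(log_lambda(1 + t)), the inner series being the compositional
   inverse of e_lambda(t) - 1 *)
Definition stirling_subst f : fps R :=
  egf (fun n => \sum_(k < n.+1) k`!%:R * f k * stirling1 lam n k).

Lemma stirling_subst_degexp x : stirling_subst (degexp lam x) = binom_series x.
Proof.
apply/fpsP => n /=; congr (_ / _).
rewrite -horner_falling (stirling1P lam n) horner_sum.
apply: eq_bigr => i _; rewrite hornerZ horner_dfalling mulrC.
by rewrite [_ * (_ / _)]mulrC divfK ?fact_unit.
Qed.

Lemma coef_functional_stirling_subst N n (F : fps R -> fps R) : (n < N)%N ->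
  (forall i, (i < N)%N -> coef_functional R N (fun f => F f i)) ->
  coef_functional R N (fun f => stirling_subst (F f) n).
Proof.
move=> nN HF.
have := @coef_functional_sum R N n.+1
  (fun k => k`!%:R * stirling1 lam n k / n`!%:R) (fun i f => F f i).
case=> [i|c cE]; first by move=> /leq_trans/(_ nN); exact: HF.
exists c => f; rewrite -cE /= mulr_suml.
by apply: eq_bigr => i _; ring.
Qed.

Lemma coef_functional_substM N n g : (n < N)%N ->
  coef_functional R N
    (fun f => stirling_subst (g * f) n - (stirling_subst g * stirling_subst f) n).
Proof.
move=> nN; apply: coef_functionalB.
  apply: coef_functional_stirling_subst => // i iN.
  by apply: coef_functional_mul => // j; exact: coef_functional_coef.
apply: coef_functional_mul => // i iN.
by apply: coef_functional_stirling_subst => // j; exact: coef_functional_coef.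
Qed.

Lemma stirling_substM f g :
  stirling_subst (f * g) = stirling_subst f * stirling_subst g.
Proof.
apply/fpsP => n; apply/eqP; rewrite -subr_eq0; apply/eqP.
move: g; apply: (@coef_functional_degexp _ lam _ _
  (coef_functional_substM n.+1 n f (ltnSn n))) => y.
(* With the exponential as the fixed left factor, the same functional is now used in the variable
   [f]. *)
rewrite mulrC [stirling_subst f * _]mulrC.
move: f; apply: (@coef_functional_degexp _ lam _ _
  (coef_functional_substM n.+1 n (degexp lam y) (ltnSn n))) => x.
by rewrite -degexpD !stirling_subst_degexp !binom_series_degexp -degexpD subrr.
Qed.

Lemma stirling_subst1 : stirling_subst 1 = 1.
Proof.
by rewrite -(degexp_at0 _ lam) stirling_subst_degexp binom_series_degexp !degexp_at0.
Qed.

Lemma stirling_substB f g :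
  stirling_subst (f - g) = stirling_subst f - stirling_subst g.
Proof.
apply/fpsP => n; rewrite coef_fpsD coef_fpsN /= -mulrBl -sumrB.
by congr (_ / _); apply: eq_bigr => i _; ring.
Qed.

(** The ring morphism structure carries the quotient and the power in [euler_gf] across the
    substitution. *)
HB.instance Definition _ :=
  GRing.isZmodMorphism.Build (fps R) (fps R) stirling_subst stirling_substB.
HB.instance Definition _ :=
  GRing.isMonoidMorphism.Build (fps R) (fps R) stirling_subst
    (stirling_subst1, stirling_substM).

Lemma stirling_subst_euler_gf r x :
  stirling_subst (euler_gf lam r x) = changhee_gf r x.
Proof.
rewrite /euler_gf /changhee_gf rmorphM rmorphXn /= stirling_subst_degexp.
rewrite rmorphM rmorphV ?degexp_unit // rmorph_nat rmorphD /=.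
by rewrite !stirling_subst_degexp binom_series1 binom_seriesN1.
Qed.

Lemma changhee_poly_stirling1 r n x :
  changhee_poly r n x = \sum_(k < n.+1) euler_poly lam r k x * stirling1 lam n k.
Proof.
by rewrite /changhee_poly -stirling_subst_euler_gf [LHS]mulrC divfK ?fact_unit.
Qed.

End StirlingTransform.

Theorem theorem3 (R : realType) (lam : R) (hlam : lam != 0)
    (r : nat) (hr : (0 < r)%N) (n : nat) :
  (forall x : R,
     changhee_poly r n x =
       \sum_(k < n.+1) euler_poly lam r k x * stirling1 lam n k) /\
  changhee_num R r n =
    \sum_(k < n.+1) euler_num lam r k * stirling1 lam n k.
(* The numbers are by definition the polynomials at [x = 0]. *)
Proof. by split=> [x|]; exact: changhee_poly_stirling1. Qed.
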